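(* Let $G=(X,E)$ be a graph on $d$ vertices. Then $$\mathrm{thab}(G) = \mathcal{D}_X\cap\mathrm{th}(\mathcal{S}_G) = \Delta(\mathrm{th}(\mathcal{S}_G)).$$
   Context: Graphs are finite, undirected and without loops. Write $x\simeq y$ if $\{x,y\}\in E$ or $x=y$. Identify $X$ with $\{1,\dots,d\}$, let $(e_x)_{x\in X}$ be the canonical orthonormal basis of $\mathbb{C}^d$, and set $\mathcal{S}_G=\mathrm{span}\{e_xe_y^* : x\simeq y\}\subseteq M_d$, where $\xi\eta^*$ is the operator $\zeta\mapsto\langle\zeta,\eta\rangle\xi$ (inner products linear in the first variable). $\mathcal{D}_X$ is the algebra of diagonal matrices with respect to $(e_x)_{x\in X}$, $\mathcal{D}_X^+$ its positive cone, and $\Delta:M_d\to\mathcal{D}_X$ the conditional expectation (deleting off-diagonal entries). Vectors in $\mathbb{R}^d$ are identified with the corresponding diagonal matrices. An orthogonal labelling (o.l.) of $G$ is a family $(a_x)_{x\in X}$ of unit vectors in a finite dimensional complex Hilbert space such that $a_x\perp a_y$ whenever $x\not\simeq y$. Let $\mathcal{P}_0(G)=\{(|\langle a_x,c\rangle|^2)_{x\in X} : (a_x)_{x\in X}\text{ an o.l. of }G,\ \|c\|\le 1\}\subseteq\mathcal{D}_X$ (here $c$ ranges over vectors in the Hilbert space of the labelling), and $\mathrm{thab}(G)=\mathcal{P}_0(G)^\flat$, where for a non-empty $\mathcal{C}\subseteq\mathcal{D}_X^+$, $\mathcal{C}^\flat=\{B\in\mathcal{D}_X^+ : \mathrm{Tr}(AB)\le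 1\ \forall A\in\mathcal{C}\}$. A quantum channel is a completely positive trace preserving linear map. If $\Phi:M_d\to M_k$ is completely positive with Kraus representation $\Phi(T)=\sum_{p=1}^m A_pTA_p^*$, put $\mathcal{S}_\Phi=\mathrm{span}\{A_p^*A_q : p,q=1,\dots,m\}$ (independent of the Kraus representation). For an operator system $\mathcal{S}\subseteq M_d$ (a linear subspace containing $I$ and closed under adjoints), let $\mathfrak{C}(\mathcal{S})$ be the set of all quantum channels $\Phi:M_d\to M_k$, $k\in\mathbb{N}$ arbitrary, with $\mathcal{S}_\Phi\subseteq\mathcal{S}$, and $$\mathrm{th}(\mathcal{S})=\{T\in M_d^+ : \Phi(T)\le I \text{ for every } \Phi\in\mathfrak{C}(\mathcal{S})\}.$$ *)

(* Defs.v *)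
From HB Require Import structures.
From mathcomp Require Import all_boot all_order all_algebra.
From mathcomp Require Import spectral.
From mathcomp Require Import complex.
From mathcomp Require Import classical_sets reals.

Set Implicit Arguments.
Unset Strict Implicit.
Unset Printing Implicit Defensive.

Import GRing.Theory Num.Theory.

Local Open Scope ring_scope.
Local Open Scope sesquilinear_scope.
Local Open Scope classical_set_scope.

Section Matrices.
Variable C : numClosedFieldType.

(* In a [numClosedFieldType], [0 <= z] entails that z is real, so that a psd
   matrix is automatically Hermitian. *)
Definition psd n (T : 'M[C]_n) : Prop :=
  forall v : 'cV[C]_n, 0 <= (v^t* *m T *m v) 0 0.

Definition loewner_le n (S T : 'M[C]_n) : Prop := psd (T - S).

Definition diag_algebra d : set 'M[C]_d := [set T | is_diag_mx T].

Definition diag_cone d : set 'M[C]_d := [set T | is_diag_mx T /\ psd T].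

Definition cond_expect d (T : 'M[C]_d) : 'M[C]_d := diag_mx (\row_x T x x).

Definition flat d (K : set 'M[C]_d) : set 'M[C]_d :=
  [set B | diag_cone B /\ forall A, K A -> \tr (A *m B) <= 1].

End Matrices.

Section Graphs.
Variables (C : numClosedFieldType) (d : nat) (e : rel 'I_d).

Definition simeq (x y : 'I_d) : bool := e x y || (x == y).

(* [delta_mx x y] is the matrix unit e_x e_y^*. *)
Definition graph_opsys : {vspace 'M[C]_d} :=
  <<[seq delta_mx p.1 p.2 | p : 'I_d * 'I_d in [pred q | simeq q.1 q.2]]>>%VS.

(* The Hilbert space is C^n (as row vectors) with
   [dotmx u v = \sum_i u_i * (v_i)^*], linear in the first variable. *)
Definition orth_labelling n (a : 'I_d -> 'rV[C]_n) : Prop :=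
  (forall x, dotmx (a x) (a x) = 1) /\
  (forall x y, ~~ simeq x y -> dotmx (a x) (a y) = 0).

Definition P0 : set 'M[C]_d :=
  [set A | exists (n : nat) (a : 'I_d -> 'rV[C]_n) (c : 'rV[C]_n),
     [/\ orth_labelling a, dotmx c c <= 1 &
         A = diag_mx (\row_x `|dotmx (a x) c| ^+ 2)]].

Definition thab : set 'M[C]_d := flat P0.

End Graphs.

Section Channels.
Variables (C : numClosedFieldType) (d : nat).

(* M_n(M_d) is realised as n x n block matrices with blocks in M_d. *)
Definition completely_positive k (Phi : 'M[C]_d -> 'M[C]_k) : Prop :=
  forall (n : nat) (T : 'I_n -> 'I_n -> 'M[C]_d),
    psd (\mxblock_(i < n, j < n) T i j) ->
    psd (\mxblock_(i < n, j < n) Phi (T i j)).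

Definition trace_preserving k (Phi : 'M[C]_d -> 'M[C]_k) : Prop :=
  forall T, \tr (Phi T) = \tr T.

Definition quantum_channel k (Phi : {linear 'M[C]_d -> 'M[C]_k}) : Prop :=
  completely_positive Phi /\ trace_preserving Phi.

Definition kraus_rep k m (Phi : 'M[C]_d -> 'M[C]_k)
    (A : 'I_m -> 'M[C]_(k, d)) : Prop :=
  forall T, Phi T = \sum_(p < m) A p *m T *m (A p)^t*.

Definition kraus_space k m (A : 'I_m -> 'M[C]_(k, d)) : {vspace 'M[C]_d} :=
  <<[seq (A p.1)^t* *m A p.2 | p : 'I_m * 'I_m]>>%VS.

(* The channels Phi with S_Phi contained in S, where S_Phi is read off a Kraus
   representation of Phi; it does not depend on the representation chosen. *)
Definition channels_of (S : {vspace 'M[C]_d}) k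
    (Phi : {linear 'M[C]_d -> 'M[C]_k}) : Prop :=
  quantum_channel Phi /\
  exists (m : nat) (A : 'I_m -> 'M[C]_(k, d)),
    kraus_rep Phi A /\ (kraus_space A <= S)%VS.

Definition th (S : {vspace 'M[C]_d}) : set 'M[C]_d :=
  [set T | psd T /\
     forall (k : nat) (Phi : {linear 'M[C]_d -> 'M[C]_k}),
       channels_of S Phi -> loewner_le (Phi T) 1%:M].

End Channels.

Arguments diag_algebra C d : clear implicits.
Arguments graph_opsys C {d} e.
Arguments P0 C {d} e.
Arguments thab C {d} e.

(* Main.v *)
From HB Require Import structures.
Require Import Defs.
From mathcomp Require Import all_boot all_order all_algebra.
From mathcomp Require Import sesquilinear spectral.
From mathcomp Require Import complex classical_sets reals.

Set Implicit Arguments.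
Unset Strict Implicit.
Unset Printing Implicit Defensive.

Import Order.TTheory GRing.Theory Num.Theory.

Local Open Scope ring_scope.
Local Open Scope sesquilinear_scope.
Local Open Scope classical_set_scope.

(** Everything follows from two inclusions, which together form the cycle
    Delta (th S_G) <= thab G <= D_X :&: th S_G <= Delta (th S_G); the last
    step is trivial, because Delta fixes diagonal matrices.

    Delta (th S_G) <= thab G ([cond_expect_th_sub_thab]).  An orthogonal
    labelling (a_x) yields the channel that measures in the canonical basis and
    prepares the state a_x a_x^* on outcome x.  Its Kraus operators are
    A_x = a_x e_x^*, and A_x^* A_y is a multiple of e_x e_y^* which vanishes
    unless x and y are equal or adjacent, so that the channel belongs to S_G.
    Testing Phi(T) <= I on the vector c gives
    sum_x T_xx |<a_x, c>|^2 <= 1, which is the inequality defining thab G for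
    Delta T.

    thab G <= th S_G ([thab_sub_th]).  Let Phi have Kraus operators A_p with
    A_p^* A_q in S_G.  For each x the vectors A_p e_x have squared norms adding
    up to 1, by trace preservation, and for x, y distinct and non-adjacent
    every A_p e_x is orthogonal to every A_q e_y.  Let v be a vector.
    [exists_dominating_unit_vector] provides a unit vector a_x in the span of
    the A_p e_x with |<a_x, v>|^2 >= sum_p |<A_p e_x, v>|^2 = <Phi(e_x e_x^* )
    v, v>.  The a_x form an orthogonal labelling, hence for a diagonal B in
    thab G with entries b_x one has
    <Phi(B) v, v> <= sum_x b_x |<a_x, v>|^2 <= |v|^2. *)

Section OrthogonalLabellingsAndChannels.
Variable C : numClosedFieldType.

Local Notation "''[' u , v ]" := (dotmx u v) : ring_scope.

(** * Inner products, traces and quadratic forms *)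

Lemma dotmxE_sum n (u v : 'rV[C]_n) : '[u, v] = \sum_i u 0 i * (v 0 i)^*.
Proof. by rewrite dotmxE mxE; apply: eq_bigr => i _; rewrite !mxE. Qed.

Lemma dotmxC n (u v : 'rV[C]_n) : '[u, v] = '[v, u]^*.
Proof. by rewrite (hermC (@dotmx C n)) /= expr0 mul1r. Qed.

Lemma trmxC_mul m n p (A : 'M[C]_(m, n)) (B : 'M[C]_(n, p)) :
  (A *m B)^t* = B^t* *m A^t*.
Proof. by rewrite trmx_mul map_mxM. Qed.

Lemma trmxC_scale m n (s : C) (A : 'M[C]_(m, n)) :
  (s *: A)^t* = s^* *: A^t*.
Proof. by apply/matrixP=> i j; rewrite !mxE rmorphM. Qed.

Lemma mxtrace_delta_mul m n (M : 'M[C]_(m, n)) x y :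
  \tr (delta_mx x y *m M) = M y x.
Proof.
rewrite -(mul_delta_mx (0 : 'I_1)) -mulmxA mxtrace_mulC trace_mx11.
by rewrite -rowE -colE !mxE.
Qed.

Lemma quad_diag n (b : 'rV[C]_n) (v : 'cV[C]_n) :
  (v^t* *m diag_mx b *m v) 0 0 = \sum_x b 0 x * `|v x 0| ^+ 2.
Proof.
rewrite mxE; apply: eq_bigr => x _.
by rewrite mul_mx_diag !mxE normCKC mulrAC mulrC mulrA.
Qed.

Lemma psd_diag n (b : 'rV[C]_n) : psd (diag_mx b) <-> forall x, 0 <= b 0 x.
Proof.
split=> [b_psd x | b_ge0 v]; last first.
  by rewrite quad_diag sumr_ge0 // => x _; rewrite mulr_ge0 ?exprn_ge0.
have := b_psd (delta_mx x 0); rewrite quad_diag (bigD1 x) //= big1 => [|y yx].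
  by rewrite !mxE !eqxx normr1 expr1n mulr1 addr0.
by rewrite mxE (negPf yx) normr0 expr0n mulr0.
Qed.

Lemma psd_diag_entry n (T : 'M[C]_n) x : psd T -> 0 <= T x x.
Proof.
move/(_ (delta_mx x 0)).
rewrite -mulmxA -colE trmx_delta map_delta_mx -rowE.
by rewrite !mxE.
Qed.

Lemma tr_mul_diag n (b : 'rV[C]_n) (T : 'M[C]_n) :
  \tr (diag_mx b *m T) = \sum_x b 0 x * T x x.
Proof. by apply: eq_bigr => x _; rewrite mul_diag_mx mxE. Qed.

Lemma quad_mxblock n q (T : 'I_n -> 'I_n -> 'M[C]_q) (v : 'I_n -> 'cV[C]_q) :
  (\mxcol_i v i)^t* *m \mxblock_(i, j) T i j *m \mxcol_j v j =
  \sum_i \sum_j (v i)^t* *m T i j *m v j.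
Proof.
have -> : (\mxcol_i v i)^t* = \mxrow_i (v i)^t*.
  by rewrite tr_mxcol; apply/matrixP=> i j; rewrite !mxE.
rewrite -mulmxA mul_mxblock_mxrow mul_mxrow_mxcol; apply: eq_bigr => i _.
by rewrite mulmx_sumr; apply: eq_bigr => j _; rewrite mulmxA.
Qed.

(** * The operator system of a graph *)

Lemma graph_opsysP d (e : rel 'I_d) (M : 'M[C]_d) :
  M \in graph_opsys C e <-> forall x y, ~~ simeq e x y -> M x y = 0.
Proof.
split=> [| M0].
  move/coord_span=> -> x y nxy; rewrite summxE big1 // => i _.
  rewrite mxE /= nth_image mxE; set p := enum_val i.
  have : simeq e p.1 p.2 := enum_valP i.
  case: andP => [[/eqP <- /eqP <-]|]; last by rewrite mulr0.
  by rewrite (negPf nxy).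
rewrite (matrix_sum_delta M); apply: memv_suml => x _; apply: memv_suml => y _.
have [sxy|/M0->] := boolP (simeq e x y); last by rewrite scale0r mem0v.
by rewrite memvZ // memv_span // (map_f _ (x := (x, y))) // mem_enum.
Qed.

(** * Maps given by Kraus operators *)

Section Kraus.
Variables (d k m : nat) (A : 'I_m -> 'M[C]_(k, d)).

(** A named function, so that it can carry the linear structure that channels
    are required to have. *)
Definition kraus_map (T : 'M[C]_d) : 'M[C]_k :=
  \sum_(p < m) A p *m T *m (A p)^t*.

Fact kraus_map_is_linear : linear kraus_map.
Proof.
move=> a S T; rewrite /kraus_map scaler_sumr -big_split /=; apply: eq_bigr => p _.
by rewrite mulmxDr mulmxDl -scalemxAr -scalemxAl.
Qed.

HB.instance Definition _ :=
  GRing.isLinear.Build C 'M[C]_d 'M[C]_k _ kraus_map kraus_map_is_linear.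

(** Moving each Kraus operator onto the vectors reduces the form of the image
    to forms of the argument. *)
Lemma sesqui_kraus_map (T : 'M[C]_d) (u v : 'cV[C]_k) :
  u^t* *m kraus_map T *m v =
  \sum_(p < m) ((A p)^t* *m u)^t* *m T *m ((A p)^t* *m v).
Proof.
rewrite mulmx_sumr mulmx_suml; apply: eq_bigr => p _.
by rewrite trmxC_mul trmxCK !mulmxA.
Qed.

(** The form of the block matrix (kraus_map T_ij) at a vector with blocks v_i is
    the sum over p of the form of (T_ij) at the vector with blocks A_p^* v_i. *)
Lemma kraus_map_cp : completely_positive kraus_map.
Proof.
move=> n T T_psd v; rewrite -(submxcolK v) quad_mxblock.
under eq_bigr => i _ do under eq_bigr => j _ do rewrite sesqui_kraus_map.
under eq_bigr => i _ do rewrite exchange_big.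
rewrite exchange_big summxE sumr_ge0 // => p _.
by rewrite -(quad_mxblock T (fun i => (A p)^t* *m submxcol v i)); apply: T_psd.
Qed.

(** Only the diagonal matrix units contribute, and the inner sum is the form of
    the image of e_x e_x^*. *)
Lemma quad_kraus_diag (b : 'rV[C]_d) (v : 'cV[C]_k) :
  (v^t* *m kraus_map (diag_mx b) *m v) 0 0 =
  \sum_x b 0 x * \sum_p `|'[(col x (A p))^T, v^T]| ^+ 2.
Proof.
rewrite sesqui_kraus_map summxE.
under eq_bigr => p _ do rewrite quad_diag.
rewrite exchange_big; apply: eq_bigr => x _; rewrite mulr_sumr.
apply: eq_bigr => p _; congr (_ * _ ^+ 2); rewrite dotmxC norm_conjC dotmxE_sum !mxE.
by congr `|_|; apply: eq_bigr => i _; rewrite !mxE mulrC.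
Qed.

End Kraus.

(** * Unit vectors in a span *)

(** Turns membership of the products B^* A in an operator system into
    orthogonality relations between columns. *)
Lemma dotmx_col k d (A B : 'M[C]_(k, d)) x y :
  '[(col x A)^T, (col y B)^T] = (B^t* *m A) y x.
Proof.
rewrite dotmxE_sum mxE; apply: eq_bigr => i _.
by rewrite !mxE mulrC.
Qed.

(** The modulus of the scalar is recorded because it is what enters the modulus
    of inner products with the normalised vector. *)
Lemma exists_unit_multiple n (w : 'rV[C]_n) : w != 0 ->
  exists2 s : C, '[s *: w, s *: w] = 1 & `|s| ^+ 2 = '[w, w]^-1.
Proof.
move=> w0; have w_gt0 : 0 < '[w, w] by rewrite dnorm_gt0.
have s2 : `|(sqrtC '[w, w])^-1| ^+ 2 = '[w, w]^-1.
  by rewrite ger0_norm ?invr_ge0 ?sqrtC_ge0 ?ltW // exprVn sqrtCK.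
by exists (sqrtC '[w, w])^-1; rewrite ?dnormZ ?s2 // mulVf // gt_eqF.
Qed.

(** Let N be the sum of the r_p r_p^*, a positive operator of trace 1, so that
    N^2 <= N.  The unit vector is N c normalised: the inequality
    <N c, c> <= <N c, c>^2 / |N c|^2 amounts to <N^2 c, c> <= <N c, c>.  When
    <N c, c> = 0 any unit vector of the span will do.  Membership in the span is
    expressed by its only consequence of interest, that vectors orthogonal to
    all the r_p are orthogonal to a. *)
Lemma exists_dominating_unit_vector n m (r : 'I_m -> 'rV[C]_n) (c : 'rV[C]_n) :
  \sum_p '[r p, r p] = 1 ->
  exists a : 'rV[C]_n, [/\ '[a, a] = 1,
    forall z, (forall p, '[r p, z] = 0) -> '[a, z] = 0 &
    \sum_p `|'[r p, c]| ^+ 2 <= `|'[a, c]| ^+ 2].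
Proof.
move=> r1; set S := \sum_p _.
have S_ge0 : 0 <= S by apply: sumr_ge0 => p _; rewrite exprn_ge0.
have [S0|S_neq0] := eqVneq S 0.
  have /existsP[p rp0] : [exists p, r p != 0].
    apply: contraT => /existsPn r0; have /eqP := r1.
    rewrite big1 ?(eq_sym 0) ?oner_eq0 // => p _.
    by have /negPn/eqP-> := r0 p; rewrite linear0l.
  have [s s1 _] := exists_unit_multiple rp0.
  exists (s *: r p); split=> // [z rz|]; last by rewrite S0 exprn_ge0.
  by rewrite linearZl_LR /= rz mulr0.
(* w is N c, and S is <N c, c>. *)
pose w := \sum_p '[c, r p] *: r p.
have wE z : '[w, z] = \sum_p '[c, r p] * '[r p, z].
  by rewrite linear_sumlz; apply: eq_bigr => p _; rewrite linearZl_LR.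
have wc : '[w, c] = S.
  by rewrite wE; apply: eq_bigr => p _; rewrite normCKC -dotmxC.
have w0 : w != 0 by apply: contraNneq S_neq0 => w0; rewrite -wc w0 linear0l.
have w_gt0 : 0 < '[w, w] by rewrite dnorm_gt0.
have wS : '[w, w] <= S.
  (* |w|^2 is an inner product in C^m of the vector f, of squared norm S, with
     a vector g whose squared norm is at most |w|^2 by Cauchy-Schwarz in C^n;
     Cauchy-Schwarz in C^m gives |w|^4 <= S |w|^2. *)
  pose f : 'rV[C]_m := \row_p '[c, r p]; pose g : 'rV[C]_m := \row_p '[w, r p].
  have fg : '[f, g] = '[w, w].
    by rewrite dotmxE_sum wE; apply: eq_bigr => p _; rewrite !mxE -dotmxC.
  have ff : '[f, f] = S.
    rewrite dotmxE_sum; apply: eq_bigr => p _.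
    by rewrite !mxE -normCK dotmxC norm_conjC.
  have gg : '[g, g] <= '[w, w].
    rewrite dotmxE_sum -[leRHS]mulr1 -r1 mulr_sumr; apply: ler_sum => p _.
    by rewrite !mxE -normCK (CauchySchwarz (@dotmx C n)).
  have fgCS : `|'[f, g]| ^+ 2 <= '[f, f] * '[g, g].
    exact: (CauchySchwarz (@dotmx C m) f g).1.
  rewrite fg ff (ger0_norm (ltW w_gt0)) in fgCS.
  have {}fgCS : '[w, w] ^+ 2 <= S * '[w, w].
    by apply: (le_trans fgCS); rewrite ler_wpM2l.
  by rewrite -(ler_pM2r w_gt0) -expr2.
have [s s1 s2] := exists_unit_multiple w0.
exists (s *: w); split=> // [z rz|].
  by rewrite linearZl_LR /= wE big1 ?mulr0 // => p _; rewrite rz mulr0.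
rewrite linearZl_LR /= wc normrM exprMn s2 (ger0_norm S_ge0) mulrC.
by rewrite ler_pdivlMr // expr2 ler_wpM2l.
Qed.

(** * The two inclusions *)

Section Graph.
Variables (d : nat) (e : rel 'I_d).

(** The channel used is the measure-and-prepare channel with Kraus operators
    a_x e_x^*. *)
Lemma cond_expect_th_sub_thab (T : 'M[C]_d) :
  th (graph_opsys C e) T -> thab C e (cond_expect T).
Proof.
move=> [T_psd T_th]; split.
  split; first exact: diag_mx_is_diag.
  by apply/psd_diag => x; rewrite mxE psd_diag_entry.
move=> _ [n [a [c [[a1 a_orth] c1 ->]]]].
pose A x : 'M[C]_(n, d) := (a x)^T *m delta_mx 0 x.
have AA x y : (A x)^t* *m A y = '[a y, a x] *: delta_mx x y.
  rewrite /A trmxC_mul trmx_delta map_delta_mx mulmxA -[_ *m _ *m (a y)^T]mulmxA.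
  rewrite [X in _ *m X *m _]mx11_scalar mul_mx_scalar -scalemxAl mul_delta_mx.
  congr (_ *: _); rewrite dotmxE_sum mxE; apply: eq_bigr => i _.
  by rewrite !mxE mulrC.
have A_id : \sum_x (A x)^t* *m A x = 1%:M.
  rewrite (matrix_sum_delta 1%:M); apply: eq_bigr => x _.
  rewrite AA a1 (bigD1 x) //= mxE eqxx big1 ?addr0 // => y yx.
  by rewrite mxE eq_sym (negPf yx) scale0r.
have A_channel : channels_of (graph_opsys C e) (kraus_map A).
  split; first split.
  - exact: kraus_map_cp.
  - move=> U; rewrite raddf_sum -[in RHS](mul1mx U) -A_id mulmx_suml raddf_sum.
    by apply: eq_bigr => x _; rewrite /= mxtrace_mulC mulmxA.
  - exists d, A; split=> //; apply/span_subvP => _ /mapP[[x y] _ ->].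
    apply/graph_opsysP => x' y' nxy; rewrite AA !mxE.
    case: andP => [[/eqP xx /eqP yy]|]; last by rewrite mulr0.
    by rewrite dotmxC a_orth ?conjC0 ?mul0r -?xx -?yy.
have := T_th _ _ A_channel c^T.
rewrite mulmxBr mulmxBl mulmx1 mxE [X in 0 <= _ + X]mxE subr_ge0 => le1.
have cc : (c^T^t* *m c^T) 0 0 = '[c, c].
  by rewrite dotmxE_sum mxE; apply: eq_bigr => i _; rewrite !mxE mulrC.
apply: le_trans c1; rewrite -cc; apply: le_trans le1.
have Ac x : (A x)^t* *m c^T = '[c, a x] *: delta_mx x 0.
  rewrite /A trmxC_mul trmx_delta map_delta_mx -mulmxA.
  rewrite [X in _ *m X]mx11_scalar mul_mx_scalar; congr (_ *: _).
  by rewrite dotmxE_sum mxE; apply: eq_bigr => i _; rewrite !mxE mulrC.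
rewrite /= sesqui_kraus_map summxE tr_mul_diag le_eqVlt; apply/predU1P; left.
apply: eq_bigr => x _; rewrite Ac trmxC_scale trmx_delta map_delta_mx.
rewrite -!scalemxAl -scalemxAr -mulmxA -rowE -colE !mxE eqxx dotmxC norm_conjC normCKC.
by rewrite mulr1n mulrA.
Qed.

(** The labelling depends on the vector v at which Phi(B) <= I is tested. *)
Lemma thab_sub_th (B : 'M[C]_d) : thab C e B -> th (graph_opsys C e) B.
Proof.
case=> [[/diag_mxP[b ->] B_psd] B_flat]; split=> // k Phi.
case=> [[_ Phi_tp] [m [A [Phi_A A_sub]]]] v.
have b_ge0 := (psd_diag b).1 B_psd.
pose r x p : 'rV[C]_k := (col x (A p))^T.
(* Trace preservation at the matrix unit e_x e_x^*. *)
have r1 x : \sum_p '[r x p, r x p] = 1.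
  have := Phi_tp (delta_mx x x).
  rewrite -[in RHS](mulmx1 (delta_mx x x)) mxtrace_delta_mul mxE eqxx mulr1n => <-.
  rewrite Phi_A raddf_sum /=; apply: eq_bigr => p _.
  by rewrite dotmx_col -mulmxA mxtrace_mulC -mulmxA mxtrace_delta_mul.
have r_orth x y p q : ~~ simeq e x y -> '[r x p, r y q] = 0.
  move=> nxy; rewrite dotmxC dotmx_col.
  have /graph_opsysP-> // : (A p)^t* *m A q \in graph_opsys C e; last exact: conjC0.
  move/span_subvP: A_sub; apply.
  by rewrite (map_f _ (x := (p, q))) // mem_enum.
have [a aP] := fin_all_exists (fun x => exists_dominating_unit_vector v^T (r1 x)).
have a_orth : orth_labelling e a.
  split=> [x|x y nxy]; first by have [] := aP x.
  have [_ ax _] := aP x; have [_ ay _] := aP y.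
  apply: ax => p; rewrite dotmxC ay ?conjC0 // => q.
  by rewrite dotmxC r_orth ?conjC0.
have [v0|v_neq0] := eqVneq v^T 0.
  by rewrite -[v]trmxK v0 trmx0 mulmx0 mxE.
have v_gt0 : 0 < '[v^T, v^T] by rewrite dnorm_gt0.
have vv : (v^t* *m v) 0 0 = '[v^T, v^T].
  by rewrite dotmxE_sum mxE; apply: eq_bigr => i _; rewrite !mxE mulrC.
rewrite mulmxBr mulmxBl mulmx1 mxE [X in 0 <= _ + X]mxE subr_ge0 vv.
(* The handle of the labelling is v, normalised. *)
have [s s1 s2] := exists_unit_multiple v_neq0.
have /B_flat : P0 C e (diag_mx (\row_x `|'[a x, s *: v^T]| ^+ 2)).
  by exists k, a, (s *: v^T); rewrite s1.
rewrite tr_mul_diag.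
have -> : (v^t* *m Phi (diag_mx b) *m v) 0 0 =
    \sum_x b 0 x * \sum_p `|'[r x p, v^T]| ^+ 2.
  by rewrite Phi_A -quad_kraus_diag.
move=> h; have {}h : (\sum_x b 0 x * `|'[a x, v^T]| ^+ 2) / '[v^T, v^T] <= 1.
  apply: le_trans h; rewrite le_eqVlt; apply/predU1P; left.
  rewrite mulr_suml; apply: eq_bigr => x _.
  rewrite !mxE eqxx mulr1n linearZr_LR /= normrM norm_conjC exprMn s2.
  by rewrite mulrAC -mulrA mulrC.
rewrite ler_pdivrMr // mul1r in h.
apply: le_trans h; apply: ler_sum => x _; rewrite ler_wpM2l //.
by have [] := aP x.
Qed.

End Graph.
End OrthogonalLabellingsAndChannels.

Theorem theorem4p5 (R : realType) (d : nat) (e : rel 'I_d)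
    (e_sym : symmetric e) (e_irr : irreflexive e) :
  thab R[i] e = diag_algebra R[i] d `&` th (graph_opsys R[i] e) /\
  diag_algebra R[i] d `&` th (graph_opsys R[i] e) =
    (@cond_expect R[i] d) @` th (graph_opsys R[i] e).
Proof.
have diagE (T : 'M[R[i]]_d) : is_diag_mx T -> cond_expect T = T.
  move=> /diag_mxP[b ->]; congr diag_mx; apply/rowP=> x.
  by rewrite !mxE eqxx mulr1n.
split; apply/seteqP; split.
- by move=> T T_thab; split; [case: T_thab => [[]] | exact: thab_sub_th].
- by move=> T [/= /diagE TE T_th]; rewrite -TE; exact: cond_expect_th_sub_thab.
- by move=> T [/= /diagE TE T_th]; exists T.
- move=> _ [T T_th <-]; split; first exact: diag_mx_is_diag.
  exact/thab_sub_th/cond_expect_th_sub_thab.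
Qed.
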